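(* There exists $t_0$ such that for every integer $t\ge t_0$, $m(K_{3,t})\le t^{-1/12}$.
   Context: For a positive integer $n$, a family $\mathcal{A}$ of labelled graphs on the vertex set $[n]=\{1,\dots,n\}$ (identified with their edge sets, i.e. with subsets of the set of $\binom n2$ pairs) has measure $\mu(\mathcal{A})=|\mathcal{A}|/2^{\binom n2}$. For a fixed graph $H$, such a family is $H$-intersecting if for all $A,B\in\mathcal{A}$ (including the case $A=B$) the graph $A\cap B$ (intersection of edge sets) contains a subgraph isomorphic to $H$ (not necessarily induced). Define $m(H)=\sup\{\mu(\mathcal{A}) : \mathcal{A}\text{ is }H\text{-intersecting}\}$, the supremum being over all $n$ and all $H$-intersecting families of graphs on $[n]$. $K_{3,t}$ is the complete bipartite graph with parts of sizes $3$ and $t$. *)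

(* Defs.v *)
From mathcomp Require Import all_boot all_order all_algebra.
From mathcomp Require Import boolp classical_sets reals.
Set Implicit Arguments.
Unset Strict Implicit.
Unset Printing Implicit Defensive.
Import Order.TTheory GRing.Theory Num.Theory.
Local Open Scope ring_scope.

Notation edge V := {e : {set V} | #|e| == 2%N}.

(* A graph on V is identified with its set of edges, so the intersection of
   two graphs on V is [:&:]. *)
Notation graph V := {set edge V}.

Definition complete_bipartite (s t : nat) : graph ('I_s + 'I_t)%type :=
  [set e : edge ('I_s + 'I_t)%type |
     [exists i : 'I_s, exists j : 'I_t, val e == [set inl i; inr j]]].

(* The copy of H inside G need not be induced. *)
Definition contains_copy (W V : finType) (H : graph W) (G : graph V) : Prop :=
  exists2 f : W -> V, injective f &
    forall e : edge W, e \in H ->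
      exists2 e' : edge V, e' \in G & val e' = f @: val e.

Definition intersecting (W : finType) (H : graph W) (n : nat)
    (F : {set graph 'I_n}) : Prop :=
  forall A B : graph 'I_n, A \in F -> B \in F -> contains_copy H (A :&: B).

Definition mu (R : realType) (n : nat) (F : {set graph 'I_n}) : R :=
  #|F|%:R / 2 ^+ 'C(n, 2)%N.

Definition measures (R : realType) (W : finType) (H : graph W) : set R :=
  [set x : R | exists (n : nat) (F : {set graph 'I_n}),
     [/\ (0 < n)%N, intersecting H F & x = mu R F]]%classic.

Arguments measures R {W} H.

Definition sup_measure (R : realType) (W : finType) (H : graph W) : R :=
  sup (measures R H).

Lemma card_edge (n : nat) : #|{: edge 'I_n}| = 'C(n, 2)%N.
Proof.
by rewrite card_sig -[in RHS](card_ord n) -card_draws cardsE.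
Qed.

Lemma mu_le1 (R : realType) (n : nat) (F : {set graph 'I_n}) : mu R F <= 1.
Proof.
rewrite /mu ler_pdivrMr ?exprn_gt0 // mul1r -natrX ler_nat -card_edge.
by rewrite -cardsT -card_powerset (leq_trans (max_card _)) // powersetT cardsT.
Qed.

(* [sup] is only meaningful on nonempty sets that are bounded above. *)
Lemma has_sup_measures (R : realType) (W : finType) (H : graph W) :
  has_sup (measures R H).
Proof.
split; last by exists 1 => _ [n [F [_ _ ->]]]; exact: mu_le1.
exists (mu R (finset.set0 : {set graph 'I_1})), 1%N, finset.set0; split => //.
by move=> A B; rewrite inE.
Qed.

(* Main.v *)
Require Import Defs.
From mathcomp Require Import all_boot all_order all_algebra.
From mathcomp Require Import boolp classical_sets reals exp.
From mathcomp Require Import ring lra.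
Set Implicit Arguments.
Unset Strict Implicit.
Unset Printing Implicit Defensive.
Import Order.TTheory GRing.Theory Num.Theory.
Local Open Scope ring_scope.

(* Let [F] be an intersecting family of measure [m] and draw [Y] uniformly
   from [F]. Revealing the edges of [Y] one at a time and randomly correcting
   each conditional bias, as in Marton's transport inequality, yields a random
   graph [D] such that [Y (+) D] is a uniform graph and such that, given [Y],
   the edges [e] lie in [D] independently, with probabilities [d Y e] satisfying
   [E (sum_e (d Y e)^2) <= 4 m^(-1/2)]. With probability [m] the complement of
   [Y (+) D] is in [F]; its intersection with [Y] is contained in [D], so that
   [D] contains a copy of [K_{3,t}], hence at least [t (t - 1)] four-cycles. But
   given [Y] the expected number of four-cycles is [O((sum_e (d Y e)^2)^2)]
   by the inequality of arithmetic and geometric means. Comparing the two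
   estimates yields [m = O(t^(-2/3))]. *)

(** * Coupling a random member of a family with a uniform point of the cube *)

Lemma big_tuple_cons (R : Type) (idx : R) (op : Monoid.com_law idx) (T : finType)
    (n : nat) (P : pred (n.+1.-tuple T)) (g : n.+1.-tuple T -> R) :
  \big[op/idx]_(y | P y) g y =
  \big[op/idx]_x \big[op/idx]_(y : n.-tuple T | P (cons_tuple x y))
     g (cons_tuple x y).
Proof.
rewrite (reindex (fun p : T * n.-tuple T => cons_tuple p.1 p.2)) /=; last first.
  exists (fun y => (thead y, behead_tuple y)) => [[x y] _|y _] /=.
    by congr (_, _); apply: val_inj.
  by rewrite [RHS]tuple_eta; apply: val_inj.
by rewrite pair_big_dep.
Qed.

(* If [a] and [b] are the densities of a family in the two halves of the cube,
   a random member lying in the half of density [a] is moved to the other half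
   with this probability, which balances the halves. For [a = 0] the
   junk value [0] is harmless. *)
Definition flip_rate (R : realFieldType) (a b : R) : R :=
  Num.max 0 ((a - b) / (2 * a)).

Lemma flip_rate0 (R : realFieldType) (a b : R) :
  0 <= a -> a <= b -> flip_rate a b = 0.
Proof.
move=> a0 ab; apply/max_idPl; rewrite mulr_le0_ge0 ?subr_le0 //.
by rewrite invr_ge0 mulr_ge0.
Qed.

Lemma flip_rateE (R : realFieldType) (a b : R) :
  0 <= b -> b <= a -> flip_rate a b = (a - b) / (2 * a).
Proof.
move=> b0 ba; apply/max_idPr; rewrite mulr_ge0 ?subr_ge0 //.
by rewrite invr_ge0 mulr_ge0 // (le_trans b0).
Qed.

Lemma flip_rate_bounds (R : realFieldType) (a b : R) : 0 <= a -> 0 <= b ->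
  0 <= flip_rate a b <= 1.
Proof.
move=> a0 b0; rewrite le_max lexx ge_max ler01 /=.
have [->|an0] := eqVneq a 0; first by rewrite mulr0 invr0 mulr0 ler01.
have a_gt0 : 0 < a by rewrite lt_def an0.
by rewrite ler_pdivrMr; lra.
Qed.

(** The denser half sends mass [|a - b| / 2] to the other half and receives none, so both end at the
    average. *)
Lemma flip_rate_mass (R : realFieldType) (a b : R) : 0 <= a -> 0 <= b ->
  (1 - flip_rate a b) * a + flip_rate b a * b = (a + b) / 2.
Proof.
move=> a0 b0; wlog: a b a0 b0 / b <= a => [hw|ba].
  have [|/ltW ab] := leP b a; first exact: hw.
  have := hw _ _ b0 a0 ab; rewrite (flip_rate0 a0 ab); lra.
rewrite (flip_rate0 b0 ba) flip_rateE //.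
have [an0|an0] := eqVneq a 0; last by field.
have -> : b = 0 by lra.
by rewrite an0; lra.
Qed.

(* [Num.sqrt] plays the role of the entropy in the usual transport argument. *)
Lemma flip_rate_sqrt (R : rcfType) (a b : R) :
  0 <= a <= 1 -> 0 <= b <= 1 ->
  (flip_rate a b ^+ 2 * a + flip_rate b a ^+ 2 * b) / 2
    + 2 * (Num.sqrt a + Num.sqrt b) <= 4 * Num.sqrt ((a + b) / 2).
Proof.
wlog: a b / b <= a => [hw a01 b01|ba /andP[a0 a1] /andP[b0 b1]].
  have [ba|/ltW ab] := leP b a; first exact: hw.
  by have := hw _ _ ab b01 a01; rewrite (addrC b a); lra.
rewrite (flip_rate0 b0 ba) flip_rateE //.
have [an0|an0] := eqVneq a 0.
  have -> : b = 0 by lra.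
  by rewrite an0 !(mul0r, mulr0, addr0, subr0, sqrtr0).
have a_gt0 : 0 < a by rewrite lt_def an0.
set s := Num.sqrt (_ / 2); set x := Num.sqrt a; set y := Num.sqrt b.
have xE : a = x ^+ 2 by rewrite sqr_sqrtr.
have yE : b = y ^+ 2 by rewrite sqr_sqrtr.
have sE : s ^+ 2 = (x ^+ 2 + y ^+ 2) / 2.
  by rewrite -xE -yE sqr_sqrtr // divr_ge0 // addr_ge0.
have x_gt0 : 0 < x by rewrite sqrtr_gt0.
have y0 : 0 <= y by rewrite sqrtr_ge0.
have s0 : 0 <= s by rewrite sqrtr_ge0.
have yx : y <= x by rewrite ler_sqrt.
have x1 : x <= 1 by rewrite -sqrtr1 ler_sqrt.
have sx : s <= x by rewrite ler_sqrt //; lra.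
(* The concavity gap of the square root is quadratic in [x - y]; since [s], [x] and [y] are at most
   1, its cofactor is at most 4. *)
have gap : (2 * s - (x + y)) * (2 * s + (x + y)) = (x - y) ^+ 2.
  have -> : (2 * s - (x + y)) * (2 * s + (x + y)) = 4 * s ^+ 2 - (x + y) ^+ 2
    by ring.
  by rewrite sE; field.
have gap4 : (x - y) ^+ 2 <= 4 * (2 * s - (x + y)).
  have h0 : 0 <= 2 * s - (x + y).
    have hp : 0 < 2 * s + (x + y) by lra.
    by rewrite -(pmulr_lge0 _ hp) gap sqr_ge0.
  by rewrite -gap mulrC ler_wpM2r //; lra.
have rate : ((a - b) / (2 * a)) ^+ 2 * a <= (x - y) ^+ 2.
  have -> : ((a - b) / (2 * a)) ^+ 2 * a = (x - y) ^+ 2 * ((x + y) / (2 * x)) ^+ 2.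
    by rewrite xE yE; field; rewrite gt_eqF.
  rewrite ler_piMr ?sqr_ge0 // expr_le1 ?divr_ge0 //; try lra.
  by rewrite ler_pdivrMr; lra.
rewrite expr0n mul0r addr0; lra.
Qed.

(** Induction on the first coordinate. Within each half the induction hypothesis corrects the tails,
    with a total that does not depend on the tail of [u]; flipping the first coordinate at rate [c]
    then balances the two halves. *)
Lemma coupling_tuple (R : rcfType) (n : nat) (f : pred (n.-tuple bool)) :
  let a : R := #|f|%:R / 2 ^+ n in
  exists d : n.-tuple bool -> 'I_n -> R,
    [/\ forall y i, 0 <= d y i <= 1,
        \sum_(y | f y) \sum_i d y i ^+ 2 <= 4 * Num.sqrt a * 2 ^+ n &
        forall u : n.-tuple bool,
          \sum_(y | f y) \prod_i
            (if tnth y i != tnth u i then d y i else 1 - d y i) = a].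
Proof.
elim: n f => [|n IHn] f /=.
  exists (fun _ _ => 0); split=> [y i||u].
  - by rewrite lexx ler01.
  - rewrite big1 => [|y _]; last by rewrite big_ord0.
    by rewrite !mulr_ge0 ?sqrtr_ge0 ?exprn_ge0.
  - under eq_bigr do rewrite big_ord0.
    by rewrite sumr_const expr0 divr1.
pose g b : pred (n.-tuple bool) := fun y => f (cons_tuple b y).
pose a b : R := #|g b|%:R / 2 ^+ n.
have pow_gt0 : 0 < 2 ^+ n :> R by rewrite exprn_gt0.
have a0 b : 0 <= a b by rewrite divr_ge0 ?ler0n ?ltW.
have a1 b : a b <= 1.
  rewrite ler_pdivrMr // mul1r -natrX ler_nat.
  by rewrite (leq_trans (max_card _)) // card_tuple card_bool.
have aE : #|f|%:R / 2 ^+ n.+1 = (a true + a false) / 2.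
  have -> : #|f| = (#|g true| + #|g false|)%N.
    by rewrite -!sum1_card big_tuple_cons big_bool.
  by rewrite natrD /a exprS; field; rewrite gt_eqF.
have [d1 [d101 d1s d1u]] := IHn (g true).
have [d0 [d001 d0s d0u]] := IHn (g false).
pose c b := flip_rate (a b) (a (~~ b)).
pose d (y : n.+1.-tuple bool) (i : 'I_n.+1) :=
  let e := if thead y then d1 else d0 in
  if unlift ord0 i is Some j then e (behead_tuple y) j else c (thead y).
have d_0 b (y : n.-tuple bool) : d (cons_tuple b y) ord0 = c b.
  by rewrite /d unlift_none.
have d_S b (y : n.-tuple bool) i :
    d (cons_tuple b y) (lift ord0 i) = (if b then d1 else d0) y i.
  rewrite /d liftK; have -> // : behead_tuple (cons_tuple b y) = y.
  exact: val_inj.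
rewrite aE; exists d; split.
- move=> y i; rewrite /d; case: (unlift _ _) => [j|].
    by case: (thead y).
  exact: flip_rate_bounds.
- have sumE b : \sum_(y | g b y) \sum_i d (cons_tuple b y) i ^+ 2 =
     a b * 2 ^+ n * c b ^+ 2
     + \sum_(y | g b y) \sum_i (if b then d1 else d0) y i ^+ 2.
    under eq_bigr => y _.
      rewrite big_ord_recl d_0.
      under eq_bigr do rewrite d_S.
      over.
    rewrite big_split /= sumr_const -[_ *+ #|_|]mulr_natl.
    by rewrite /a divfK ?gt_eqF.
  rewrite big_tuple_cons big_bool !sumE (exprS 2 n).
  have a01 b : 0 <= a b <= 1 by rewrite a0 a1.
  have loc := flip_rate_sqrt (a01 true) (a01 false).
  set w := 2 ^+ n in pow_gt0 d1s d0s loc *.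
  (* The cost of the tails, by induction, plus that of the first coordinate, grouped to fit
     [flip_rate_sqrt]. *)
  apply: (@le_trans _ _ (2 * w * ((c true ^+ 2 * a true + c false ^+ 2 * a false) / 2
    + 2 * (Num.sqrt (a true) + Num.sqrt (a false))))).
    by move: d1s d0s => /=; rewrite -/(a true) -/(a false); lra.
  by rewrite [leRHS]mulrC ler_wpM2l // mulr_ge0 // ltW.
- move=> u; rewrite (tuple_eta u) big_tuple_cons big_bool /=.
  set v := behead_tuple u.
  have prodE b : \sum_(y | g b y) \prod_i
      (if tnth (cons_tuple b y) i != tnth (cons_tuple (thead u) v) i
       then d (cons_tuple b y) i else 1 - d (cons_tuple b y) i) =
     (if b != thead u then c b else 1 - c b) * a b.
    under eq_bigr => y _.
      rewrite big_ord_recl d_0 !tnth0.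
      under eq_bigr do rewrite d_S !tnthS.
      over.
    rewrite -big_distrr /=; congr (_ * _).
    by case: (b); [exact: d1u|exact: d0u].
  rewrite !prodE; have := flip_rate_mass (a0 true) (a0 false).
  have := flip_rate_mass (a0 false) (a0 true).
  by rewrite /c; case: (thead u) => /=; lra.
Qed.

(* The last clause says that correcting a uniform [Y] in [F] at the edges [e],
   independently with probabilities [d Y e], produces a uniform set [U]: the
   common value [a] is [#|F|] times the probability [2 ^- #|E|]. *)
Lemma coupling (R : rcfType) (E : finType) (F : {set {set E}}) :
  let a : R := #|F|%:R / 2 ^+ #|E| in
  exists d : {set E} -> E -> R,
    [/\ forall Y e, 0 <= d Y e <= 1,
        \sum_(Y in F) \sum_e d Y e ^+ 2 <= 4 * Num.sqrt a * 2 ^+ #|E| &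
        forall U : {set E},
          \sum_(Y in F) \prod_e
            (if (e \in Y) != (e \in U) then d Y e else 1 - d Y e) = a].
Proof.
pose enc (Y : {set E}) : #|E|.-tuple bool := [tuple enum_val i \in Y | i < #|E|].
pose dec (y : #|E|.-tuple bool) : {set E} := [set e | tnth y (enum_rank e)].
have decK : cancel dec enc.
  by move=> y; apply: eq_from_tnth => i; rewrite tnth_mktuple inE enum_valK.
have encK : cancel enc dec.
  by move=> Y; apply/setP => e; rewrite inE tnth_mktuple enum_rankK.
have dec_bij : {on [pred Y | Y \in F], bijective dec}.
  by exists enc => y _; [exact: decK|exact: encK].
have rank_bij : {on [pred i : 'I_#|E| | true], bijective (@enum_rank E)}.
  exact/onW_bij/enum_rank_bij.
have [d [d01 ds du]] := @coupling_tuple R #|E| [pred y | dec y \in F].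
have cardF : #|[pred y | dec y \in F]| = #|F|.
  by rewrite -!sum1_card (reindex _ dec_bij).
rewrite /= cardF in ds du; exists (fun Y e => d (enc Y) (enum_rank e)); split.
- by move=> Y e.
- rewrite (reindex _ dec_bij); apply: le_trans ds.
  rewrite le_eqVlt; apply/orP; left; apply/eqP/eq_bigr => y _.
  by rewrite decK [RHS](reindex _ rank_bij).
- move=> U; rewrite -(du (enc U)) (reindex _ dec_bij); apply: eq_bigr => y _.
  rewrite decK [RHS](reindex _ rank_bij); apply: eq_bigr => e _.
  by rewrite inE tnth_mktuple enum_rankK.
Qed.

(** * The product measure on subsets *)

Definition random_mass (R : pzRingType) (E : finType) (p : E -> R) (D : {set E}) : R :=
  \prod_e (if e \in D then p e else 1 - p e).

Lemma random_mass_ge0 (R : realDomainType) (E : finType) (p : E -> R) (D : {set E}) :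
  (forall e, 0 <= p e <= 1) -> 0 <= random_mass p D.
Proof.
move=> p01; apply: prodr_ge0 => e _; have /andP[p0 p1] := p01 e.
by case: ifP; rewrite ?subr_ge0.
Qed.

Lemma sum_random_mass_supset (R : comPzRingType) (E : finType) (p : E -> R)
    (T : {set E}) :
  \sum_(D : {set E} | T \subset D) random_mass p D = \prod_(e in T) p e.
Proof.
(* Omitting an element of [T] gets weight 0, and every other element has total weight 1; expanding
   the product over subsets gives the sum. *)
transitivity (\prod_e (p e + (if e \in T then 0 else 1 - p e))); last first.
  rewrite [RHS]big_mkcond; apply: eq_bigr => e _.
  by case: ifP; rewrite ?addr0 // addrC subrK.
rewrite bigA_distr [LHS]big_mkcond; apply: eq_bigr => D _.
case: ifPn => [/fintype.subsetP TD|/fintype.subsetPn[e eT eD]].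
  by apply: eq_bigr => e _; case: ifPn => // eD; rewrite ifN //; apply: contra eD; apply: TD.
by rewrite (bigD1 e) //= (negbTE eD) eT mul0r.
Qed.

(** * Expected number of four-cycles in a random graph *)

Section FourCycles.
Variables (R : realFieldType) (V : finType) (p : edge V -> R).
Hypothesis p01 : forall e, 0 <= p e <= 1.

Let p0 e : 0 <= p e. Proof. by case/andP: (p01 e). Qed.

Definition adj (D : graph V) (u x : V) := [exists e in D, val e == [set u; x]].

(** The sum has at most one term. It extends [p] by 0 to the diagonal, so that sums can run freely
    over vertices. *)
Definition pair_rate (u x : V) : R := \sum_(e | val e == [set u; x]) p e.

Definition is_four_cycle (D : graph V) (u v x y : V) :=
  [&& u != v, x != y, adj D u x, adj D v x, adj D u y & adj D v y].

Lemma pair_rate_ge0 u x : 0 <= pair_rate u x.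
Proof. by apply: sumr_ge0 => e _. Qed.

Lemma pair_rateE (e : edge V) u x : val e = [set u; x] -> pair_rate u x = p e.
Proof.
move=> eE; rewrite /pair_rate (big_pred1 e) // => e' /=.
by rewrite -eE (inj_eq val_inj).
Qed.

Lemma edge_neq (e : edge V) u x : val e = [set u; x] -> u != x.
Proof. by move=> eE; have := valP e; rewrite eE cards2; case: (u != x). Qed.

Lemma adj_mem D (e : edge V) u x : val e = [set u; x] -> adj D u x = (e \in D).
Proof.
move=> eE; apply/existsP/idP => [[e' /andP[e'D /eqP]]|eD].
  by rewrite -eE => /val_inj <-.
by exists e; rewrite eD eE eqxx.
Qed.

Lemma four_cycle_mass u v x y :
  \sum_(D | is_four_cycle D u v x y) random_mass p D <=
  pair_rate u x * pair_rate v x * (pair_rate u y * pair_rate v y).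
Proof.
(* If some graph has this four-cycle, its four edges exist independently of [D]; otherwise the left
   side is 0. *)
have [/existsP[D0]|/existsPn none] :=
    boolP [exists D, is_four_cycle D u v x y]; last first.
  rewrite big_pred0 => [|D]; last exact/negbTE/none.
  by rewrite !mulr_ge0 // pair_rate_ge0.
case/and5P=> uv xy /existsP[e1 /andP[_ /eqP e1E]] /existsP[e2 /andP[_ /eqP e2E]].
case/andP=> /existsP[e3 /andP[_ /eqP e3E]] /existsP[e4 /andP[_ /eqP e4E]].
rewrite (pair_rateE e1E) (pair_rateE e2E) (pair_rateE e3E) (pair_rateE e4E).
have ux := edge_neq e1E; have vx := edge_neq e2E.
have uy := edge_neq e3E; have vy := edge_neq e4E.
(* Edges are unordered, so [u != v] alone does not separate them: [u] must also differ from the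
   other end of the second edge. *)
have neqL (e e' : edge V) a b : val e = [set u; a] -> val e' = [set v; b] ->
    u != b -> e != e'.
  move=> eE e'E ub; apply: contraNneq ub => ee'.
  by have := set21 u a; rewrite -eE ee' e'E !inE (negbTE uv).
have neqR (e e' : edge V) a b : val e = [set a; x] -> val e' = [set b; y] ->
    b != x -> e != e'.
  move=> eE e'E bx; apply: contraNneq bx => ee'.
  by have := set22 a x; rewrite -eE ee' e'E !inE (negbTE xy) orbF eq_sym.
have e12 : e1 != e2 by apply: neqL e1E e2E ux.
have e14 : e1 != e4 by apply: neqL e1E e4E uy.
have e34 : e3 != e4 by apply: neqL e3E e4E uy.
have e32 : e3 != e2 by apply: neqL e3E e2E ux.
have e13 : e1 != e3 by apply: neqR e1E e3E ux.
have e24 : e2 != e4 by apply: neqR e2E e4E vx.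
have -> : p e1 * p e2 * (p e3 * p e4) = \prod_(e in [set e1; e2; e3; e4]) p e.
  rewrite -!finset.setUA !big_setU1 ?inE ?negb_or ?e12 ?e13 ?e14 ?e34 ?e24 //=.
    by rewrite big_set1; ring.
  by rewrite eq_sym e32.
rewrite -sum_random_mass_supset [leLHS]big_mkcond [leRHS]big_mkcond.
apply: ler_sum => D _; case: ifP => [|_]; last first.
  by case: ifP => // _; apply: random_mass_ge0.
rewrite /is_four_cycle (adj_mem _ e1E) (adj_mem _ e2E) (adj_mem _ e3E) (adj_mem _ e4E).
case/and5P=> _ _ D1 D2 /andP[D3 D4]; rewrite ifT //.
by apply/fintype.subsetP => e; rewrite !inE -!orbA => /or4P[] /eqP->.
Qed.

(** The factor 2 counts the orderings of the ends of an edge. *)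
Lemma sum_pair_rate_sqr :
  \sum_u \sum_x pair_rate u x ^+ 2 <= 2 * \sum_e p e ^+ 2.
Proof.
have sqE u x : pair_rate u x ^+ 2 = \sum_(e : edge V | val e == [set u; x]) p e ^+ 2.
  have [/existsP[e /eqP eE]|/existsPn none] :=
      boolP [exists e : edge V, val e == [set u; x]].
    rewrite (pair_rateE eE) (big_pred1 e) // => e'.
    by rewrite -eE /= (inj_eq val_inj).
  by rewrite /pair_rate !big_pred0 ?expr0n // => e; apply/negbTE.
have card_ends (e : edge V) : (#|[set q : V * V | val e == [set q.1; q.2]]| <= 2)%N.
  have /cards2P[a [b [ab eE]]] := valP e.
  apply: leq_trans (_ : #|[set (a, b); (b, a)]| <= 2)%N; last first.
    by rewrite cards2; case: eqP.
  apply: subset_leq_card; apply/fintype.subsetP => -[u x].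
  rewrite !finset.in_set !finset.in_set1 !xpair_eqE => /eqP eux.
  have := set21 u x; have := set22 u x; have := edge_neq eux.
  rewrite -eux eE !inE => ux /orP[] /eqP xE /orP[] /eqP uE.
  - by rewrite uE xE eqxx in ux.
  - by rewrite uE xE !eqxx ?orbT.
  - by rewrite uE xE !eqxx ?orbT.
  - by rewrite uE xE eqxx in ux.
rewrite pair_bigA /=; under eq_bigr do rewrite sqE.
rewrite (exchange_big_dep predT) // mulr_sumr; apply: ler_sum => e _.
rewrite sumr_const -[leLHS]mulr_natl ler_wpM2r ?sqr_ge0 // ler_nat.
by apply: leq_trans (card_ends e); rewrite cardsE.
Qed.

(** A four-cycle is the union of two perfect matchings. The product of their weights is at most half
    the sum of the squares, and each squared weight sums to [N ^+ 2] because the two edges of a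
    matching share no vertex. *)
Lemma sum_pair_rate_four_cycle :
  \sum_u \sum_v \sum_x \sum_y
     pair_rate u x * pair_rate v x * (pair_rate u y * pair_rate v y)
  <= (\sum_u \sum_x pair_rate u x ^+ 2) ^+ 2.
Proof.
set N := \sum_u \sum_x _ ^+ 2.
have NE : \sum_u \sum_v \sum_x \sum_y pair_rate u x ^+ 2 * pair_rate v y ^+ 2 = N ^+ 2.
  rewrite (expr2 N) big_distrlr /=; apply: eq_bigr => u _; apply: eq_bigr => v _.
  by rewrite big_distrlr.
have NE' : \sum_u \sum_v \sum_x \sum_y pair_rate u y ^+ 2 * pair_rate v x ^+ 2 = N ^+ 2.
  by rewrite -NE; apply: eq_bigr => u _; apply: eq_bigr => v _; rewrite exchange_big.
set L := (leLHS); suff: L + L <= N ^+ 2 + N ^+ 2 by lra.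
rewrite -{1}NE -NE' /L.
do 4![rewrite -!big_split /=; apply: ler_sum => ? _].
set a := pair_rate _ _; set b := pair_rate _ _.
set c := pair_rate _ _; set e := pair_rate _ _.
have := sqr_ge0 (a * e - b * c); rewrite sqrrB; lra.
Qed.
End FourCycles.

(** * Copies of complete bipartite graphs in a random graph *)

Lemma contains_copy_subset (W V : finType) (H : graph W) (G G' : graph V) :
  G \subset G' -> contains_copy H G -> contains_copy H G'.
Proof.
move=> /fintype.subsetP GG' [f f_inj fH]; exists f => // e /fH[e' e'G eE].
by exists e' => //; apply: GG'.
Qed.

Lemma card_offdiag (T : finType) :
  #|[set p : T * T | p.1 != p.2]| = (#|T| * #|T|.-1)%N.
Proof.
have -> : [set p : T * T | p.1 != p.2] = ~: [set (x, x) | x : T].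
  apply/setP => -[x y]; rewrite !inE /=; congr negb.
  apply/eqP/imsetP => [->|[z _ [-> ->]] //]; by exists y.
have := cardsC [set (x, x) | x : T]; rewrite card_imset => [|x y []//].
rewrite card_prod; case: #|T| => [|k] /eqP; first by rewrite addn_eq0 => /andP[_ /eqP].
by rewrite [in X in _ == X -> _]mulnS eqn_add2l => /eqP.
Qed.

(** Two fixed vertices of the side of size [s] form a four-cycle with each ordered pair of distinct
    vertices of the other side. *)
Lemma four_cycles_of_bipartite (s t : nat) (V : finType) (D : graph V) : (1 < s)%N ->
  contains_copy (complete_bipartite s t) D ->
  (t * t.-1 <= #|[set q : V * V * (V * V) |
     is_four_cycle D q.1.1 q.1.2 q.2.1 q.2.2]|)%N.
Proof.
case: s => [|[|s]] // _ [f f_inj fH].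
have adj_f i j : adj D (f (inl i)) (f (inr j)).
  have e2 : #|[set inl i; inr j] : {set 'I_s.+2 + 'I_t}| == 2%N by rewrite cards2.
  have [|e' e'D e'E] := fH (exist (fun e : {set _} => #|e| == 2%N) _ e2).
    rewrite inE; apply/existsP; exists i; apply/existsP; exists j.
    exact: eqxx.
  rewrite /= imsetU1 imset_set1 in e'E.
  by apply/existsP; exists e'; rewrite e'D; apply/eqP.
pose g (p : 'I_t * 'I_t) : V * V * (V * V) :=
  ((f (inl ord0), f (inl ord_max)), (f (inr p.1), f (inr p.2))).
have g_inj : injective g.
  by move=> [i j] [i' j'] [/f_inj[->] /f_inj[->]].
rewrite -[t in (t * t.-1)%N]card_ord -card_offdiag -(card_imset _ g_inj).
apply/subset_leq_card/fintype.subsetP => _ /imsetP[[i j] ij ->].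
rewrite inE /= in ij; rewrite inE /= /is_four_cycle !adj_f !andbT.
by rewrite !(inj_eq f_inj) /= (inj_eq (@inr_inj _ _)) ij.
Qed.

Lemma copy_mass (R : realFieldType) (s t : nat) (V : finType) (p : edge V -> R) :
  (1 < s)%N -> (1 < t)%N -> (forall e, 0 <= p e <= 1) ->
  t%:R * \sum_(D : graph V | `[< contains_copy (complete_bipartite s t) D >])
    random_mass p D <= 3 * \sum_e p e ^+ 2.
Proof.
move=> s1 t1 p01; set q := \sum_(D | _) _; set S := \sum_e _.
have S0 : 0 <= S by apply: sumr_ge0 => e _; apply: sqr_ge0.
have mass0 D : 0 <= random_mass p D by apply: random_mass_ge0.
have q0 : 0 <= q by apply: sumr_ge0.
have q1 : q <= 1.
  have <- : \sum_(D : graph V) random_mass p D = 1.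
    transitivity (\prod_(e in finset.set0) p e); last by rewrite big_set0.
    rewrite -sum_random_mass_supset; apply: eq_bigl => D; exact/esym/finset.sub0set.
  rewrite [leRHS](bigID (fun D => `[< contains_copy (complete_bipartite s t) D >])).
  by rewrite lerDl sumr_ge0.
(* Markov's inequality for the number of four-cycles. *)
have cycles : (t * t.-1)%:R * q <= (2 * S) ^+ 2.
  apply: (@le_trans _ _ (\sum_u \sum_v \sum_x \sum_y
      \sum_(D | is_four_cycle D u v x y) random_mass p D)).
    rewrite pair_bigA /=; under [leRHS]eq_bigr do rewrite pair_bigA /=.
    rewrite pair_bigA /= (exchange_big_dep predT) //= mulr_sumr.
    rewrite big_mkcond /=; apply: ler_sum => D _.
    rewrite sumr_const; case: asboolP => [copy|_]; last exact: mulrn_wge0.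
    rewrite -[leRHS]mulr_natl ler_wpM2r // ler_nat.
    apply: leq_trans (four_cycles_of_bipartite s1 copy) _.
    by rewrite cardsE.
  apply: (@le_trans _ _ (\sum_u \sum_v \sum_x \sum_y
     pair_rate p u x * pair_rate p v x * (pair_rate p u y * pair_rate p v y))).
    by do 4![apply: ler_sum => ? _]; apply: four_cycle_mass.
  apply: le_trans (sum_pair_rate_four_cycle p) _.
  rewrite lerXn2r ?nnegrE ?mulr_ge0 ?sum_pair_rate_sqr //.
  by do 2![apply: sumr_ge0 => ? _]; apply: sqr_ge0.
have t2 : t%:R ^+ 2 <= 2 * (t * t.-1)%:R :> R.
  rewrite -natrX -natrM ler_nat mulnCA leq_mul2l.
  by case: t t1 {q q0 q1 cycles} => [|[|t]] //= _; rewrite mul2n -addnn addSn ltnS leq_addl.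
(* Weakening [q] to [q ^+ 2] allows a square root to be taken, which leaves a bound linear in [S]
   that can be averaged over [Y]. The constant 3 is the square root of 8 rounded up. *)
have qq : q ^+ 2 <= q by rewrite expr2 ler_piMr.
rewrite -(@ler_pXn2r _ 2) ?nnegrE ?mulr_ge0 // !exprMn.
apply: (@le_trans _ _ (2 * (t * t.-1)%:R * q)).
  apply: (@le_trans _ _ (t%:R ^+ 2 * q)); first by rewrite ler_wpM2l ?sqr_ge0.
  by rewrite ler_wpM2r.
rewrite exprMn in cycles; have := sqr_ge0 S; lra.
Qed.

(** * The bound on the measure of an intersecting family *)

Lemma mu_bound (R : realType) (n s t : nat) (F : {set graph 'I_n}) :
  (1 < s)%N -> (1 < t)%N -> intersecting (complete_bipartite s t) F ->
  mu R F ^+ 3 * t%:R ^+ 2 <= 144.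
Proof.
move=> s1 t1 Fint; set m := mu R F.
have [d [d01 ds du]] := @coupling R (edge 'I_n) F.
rewrite card_edge -/(mu R F) -/m in ds du.
set N : R := 2 ^+ 'C(n, 2)%N in ds.
have N_gt0 : 0 < N by rewrite exprn_gt0.
have m_ge0 : 0 <= m by rewrite divr_ge0 // ltW.
have FN : #|F|%:R = m * N by rewrite /m /mu divfK // gt_eqF.
clearbody m.
(* The correction that takes [Y] to the complement of [B]; it contains [Y :&: B]. *)
pose diff (Y B : graph 'I_n) : graph 'I_n := [set e | (e \in Y) == (e \in B)].
have diffK Y : cancel (diff Y) (diff Y).
  by move=> B; apply/setP => e; rewrite !inE; case: (e \in Y); case: (e \in B).
have diff_copy Y B : Y \in F -> B \in F ->
    contains_copy (complete_bipartite s t) (diff Y B).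
  move=> YF BF; apply: contains_copy_subset (Fint _ _ YF BF).
  by apply/fintype.subsetP => e; rewrite !inE => /andP[-> ->].
(* For each [B], the coupling at [U = ~: B] gives [m], and there are [m * N] choices of [B]. *)
have total : \sum_(Y in F) \sum_(B in F) random_mass (d Y) (diff Y B) = m * N * m.
  rewrite exchange_big /= -FN mulr_natl -sumr_const; apply: eq_bigr => B _.
  rewrite -(du (~: B)); apply: eq_bigr => Y _; apply: eq_bigr => e _.
  by rewrite !inE; case: (e \in Y); case: (e \in B).
have bound Y : Y \in F ->
    t%:R * \sum_(B in F) random_mass (d Y) (diff Y B) <= 3 * \sum_e d Y e ^+ 2.
  move=> YF; apply: le_trans (copy_mass s1 t1 (d01 Y)); rewrite ler_wpM2l //.
  rewrite [leRHS](reindex (diff Y)) /=; last first.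
    by exists (diff Y) => ? _; apply: diffK.
  rewrite [leLHS]big_mkcond [leRHS]big_mkcond; apply: ler_sum => B _.
  case: ifP => [BF|_]; first by rewrite ifT //; apply/asboolP/diff_copy.
  by case: ifP => // _; apply: random_mass_ge0.
have : t%:R * (m * N * m) <= 3 * (4 * Num.sqrt m * N).
  rewrite -total mulr_sumr.
  apply: (@le_trans _ _ (\sum_(Y in F) 3 * \sum_e d Y e ^+ 2)).
    exact: ler_sum.
  by rewrite -mulr_sumr ler_wpM2l.
have -> : t%:R * (m * N * m) = t%:R * m ^+ 2 * N by ring.
rewrite mulrA ler_pM2r // => key.
have := m_ge0; rewrite le_eqVlt => /orP[/eqP <-|m_gt0].
  by rewrite expr0n mul0r.
(* Multiplying by [m] turns the claim into the square of [key], with [144 = 12 ^+ 2]. *)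
rewrite -(ler_pM2r m_gt0).
have -> : m ^+ 3 * t%:R ^+ 2 * m = (t%:R * m ^+ 2) ^+ 2 by ring.
have -> : 144 * m = (3 * (4 * Num.sqrt m)) ^+ 2.
  by rewrite !exprMn sqr_sqrtr //; ring.
by rewrite ler_pXn2r // nnegrE ?mulr_ge0 // ?sqrtr_ge0.
Qed.

Theorem theorem2p2 (R : realType) :
  exists t0 : nat, forall t : nat, (t0 <= t)%N ->
    sup_measure R (complete_bipartite 3 t) <= t%:R `^ (- (1 / 12)).
Proof.
(* For [t >= 144] the bound [144 / t ^+ 2] on the cube of the measure is at most [1 / t]; the
   twelfth power is smaller than the cube since the measure is at most 1. *)
exists 144%N => t t144.
have [ne _] := has_sup_measures R (complete_bipartite 3 t).
apply: sup_le_ub => // _ [n [F [_ Fint ->]]].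
have t1 : (1 < t)%N by apply: leq_trans t144.
have t_gt0 : 0 < t%:R :> R by rewrite ltr0n ltnW.
have m0 : 0 <= mu R F by rewrite divr_ge0 // exprn_ge0.
have m1 := mu_le1 R F.
rewrite -(@ler_pXn2r _ 12) ?nnegrE ?powR_ge0 //.
have -> : (t%:R `^ (- (1 / 12))) ^+ 12 = t%:R ^-1 :> R.
  rewrite -powR_mulrn ?powR_ge0 // -powRrM.
  have -> : - (1 / 12) * 12%:R = -1 :> R by field.
  by rewrite powR_inv1 // ltW.
apply: (@le_trans _ _ (mu R F ^+ 3)); first by rewrite ler_wiXn2l.
have bnd := mu_bound R (isT : (1 < 3)%N) t1 Fint.
rewrite -(ler_pM2r (exprn_gt0 2 t_gt0)) (le_trans bnd) //.
by rewrite expr2 mulKf ?gt_eqF // ler_nat.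
Qed.
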